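(* Let $\mathcal E$ be a trace-preserving linear map on $n$-qubit operators, with Pauli-transfer-matrix blocks $\mathcal E_{00},\mathcal E_{01},\mathcal E_{10},\mathcal E_{11}$ relative to the partition $\mathbb Z\oplus\mathbb Z^\perp$, and assume $\mathcal E_{00}$ is invertible on the $\mathbb Z$-subspace. Define, in block form, $$\mathcal E_c=\begin{pmatrix}\mathcal E_{00}&0\\ \mathcal E_{10}&\mathcal E_{11}-\mathcal E_{10}\mathcal E_{00}^{-1}\mathcal E_{01}\end{pmatrix},\qquad \mathcal E_q=\begin{pmatrix}\mathbb I&\mathcal E_{00}^{-1}\mathcal E_{01}\\ 0&\mathbb I\end{pmatrix}.$$ Then $\mathcal E=\mathcal E_c\,\mathcal E_q$; both $\mathcal E_c$ and $\mathcal E_q$ are trace-preserving; $\mathcal E_c$ is classically tractable, i.e. $\Pi_{\mathbb Z}\mathcal E_c\Pi_\perp=0$; and $\mathcal E_q=\mathcal I+\mathcal N$, where $\mathcal N=\Pi_{\mathbb Z}\,(\mathcal E_{00}^{-1}\mathcal E_{01})\,\Pi_\perp$ maps $\mathbb Z^\perp$ into $\mathbb Z$.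
   Context: Linear maps on operators on $(\mathbb C^2)^{\otimes n}$ are identified with their Pauli transfer matrices, i.e. their $4^n\times4^n$ matrices in the orthonormal basis of normalized sign-free Pauli operators $P/\sqrt{2^n}$, $P\in\{I,X,Y,Z\}^{\otimes n}$, for the inner product $\langle\langle A|B\rangle\rangle=\operatorname{Tr}(A^\dagger B)$. $\mathbb Z$ denotes the (span of the) Pauli operators $\{I,Z\}^{\otimes n}$ and $\mathbb Z^\perp$ its orthogonal complement (span of the remaining Pauli operators); $\Pi_{\mathbb Z}$ and $\Pi_\perp=\mathbb I-\Pi_{\mathbb Z}$ are the corresponding orthogonal projectors. The blocks are $\mathcal E_{00}=\Pi_{\mathbb Z}\mathcal E\Pi_{\mathbb Z}$, $\mathcal E_{01}=\Pi_{\mathbb Z}\mathcal E\Pi_\perp$, $\mathcal E_{10}=\Pi_\perp\mathcal E\Pi_{\mathbb Z}$, $\mathcal E_{11}=\Pi_\perp\mathcal E\Pi_\perp$. $\mathcal I$ is the identity map. A map is called classically tractable if its upper-right block $\Pi_{\mathbb Z}(\cdot)\Pi_\perp$ vanishes. *)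

(* Defs.v *)
From HB Require Import structures.
From mathcomp Require Import all_boot all_order all_algebra.
From mathcomp Require Import reals.
From mathcomp Require Export complex.
(* Required without Import: the notation "A ^t k" of mxtens clashes with the
   conjugate-transpose notation of sesquilinear. *)
From mathcomp Require mxtens.

Set Implicit Arguments.
Unset Strict Implicit.
Unset Printing Implicit Defensive.

Import Order.TTheory GRing.Theory Num.Theory.
Local Open Scope ring_scope.

Variant pauli := PauliI | PauliX | PauliY | PauliZ.

Definition pauli_code (p : pauli) : bool * bool :=
  match p with
  | PauliI => (false, false)
  | PauliX => (true, false)
  | PauliY => (true, true)
  | PauliZ => (false, true)
  end.

Definition pauli_decode (c : bool * bool) : pauli :=
  match c with
  | (false, false) => PauliI
  | (true, false) => PauliX
  | (true, true) => PauliY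
  | (false, true) => PauliZ
  end.

Lemma pauli_codeK : cancel pauli_code pauli_decode.
Proof. by case. Qed.

HB.instance Definition _ := Finite.copy pauli (can_type pauli_codeK).

Section Pauli.
Variable C : numClosedFieldType.

Definition pauli_mx (p : pauli) : 'M[C]_2 :=
  match p with
  | PauliI => 1%:M
  | PauliX => \matrix_(i, j) (i != j)%:R
  | PauliY => \matrix_(i, j) (if i == j then 0 else if i == 0 then - 'i else 'i)
  | PauliZ => \matrix_(i, j) (if i != j then 0 else if i == 0 then 1 else - 1)
  end.

Fixpoint pauli_op (n : nat) : n.-tuple pauli -> 'M[C]_(2 ^ n) :=
  match n with
  | 0 => fun _ => 1%:M
  | m.+1 => fun s =>
      castmx (esym (expnS 2 m), esym (expnS 2 m))
        (mxtens.tensmx (pauli_mx (thead s)) (pauli_op [tuple of behead s]))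
  end.

Variable n : nat.

Definition npauli (s : n.-tuple pauli) : 'M[C]_(2 ^ n) :=
  (sqrtC (2 ^ n)%:R)^-1 *: pauli_op s.

Definition hs (A B : 'M[C]_(2 ^ n)) : C := \tr (map_mx Num.conj A^T *m B).

Definition trace_preserving (E : 'End('M[C]_(2 ^ n))) : Prop :=
  forall A, \tr (E A) = \tr A.

Definition Zset : {set n.-tuple pauli} :=
  [set s : n.-tuple pauli | all (mem [:: PauliI; PauliZ]) s].

Definition Zspace : {vspace 'M[C]_(2 ^ n)} :=
  <<[seq npauli s | s in Zset]>>%VS.

Definition Zperp : {vspace 'M[C]_(2 ^ n)} :=
  <<[seq npauli s | s in ~: Zset]>>%VS.

Definition projZ : 'End('M[C]_(2 ^ n)) :=
  linfun (fun A => \sum_(s in Zset) hs (npauli s) A *: npauli s).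

Definition projPerp : 'End('M[C]_(2 ^ n)) := (\1 - projZ)%VF.

(* The Pauli basis is listed with the elements of {I, Z}^n first, so that the
   partition of the basis is the block decomposition of a matrix of size
   #|Zset| + #|~: Zset| = 2^n + (4^n - 2^n). *)
Local Notation dimZ := #|Zset|.
Local Notation dimP := #|~: Zset|.

Definition basis_string (k : 'I_(dimZ + dimP)) : n.-tuple pauli :=
  match split k with
  | inl i => enum_val i
  | inr j => enum_val j
  end.

Definition basis (k : 'I_(dimZ + dimP)) : 'M[C]_(2 ^ n) :=
  npauli (basis_string k).

Definition ptm (E : 'End('M[C]_(2 ^ n))) : 'M[C]_(dimZ + dimP) :=
  \matrix_(i, j) hs (basis i) (E (basis j)).

(* The inverse of ptm: the map \sum_(i, j) M i j |P_i>><<P_j|, whose Pauli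
   transfer matrix is M since the normalized Paulis form an orthonormal basis. *)
Definition of_ptm (M : 'M[C]_(dimZ + dimP)) : 'End('M[C]_(2 ^ n)) :=
  linfun (fun A => \sum_i \sum_j (M i j * hs (basis j) A) *: basis i).

(* As E_00 = Pi_Z E Pi_Z, E_01 = Pi_Z E Pi_perp, etc., are zero outside the
   corresponding block of the Pauli basis, they are represented by that block;
   inverting E_00 on the Z-subspace is inverting the square matrix ptm00 E. *)
Definition ptm00 (E : 'End('M[C]_(2 ^ n))) : 'M[C]_dimZ := ulsubmx (ptm E).
Definition ptm01 (E : 'End('M[C]_(2 ^ n))) : 'M[C]_(dimZ, dimP) :=
  ursubmx (ptm E).
Definition ptm10 (E : 'End('M[C]_(2 ^ n))) : 'M[C]_(dimP, dimZ) :=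
  dlsubmx (ptm E).
Definition ptm11 (E : 'End('M[C]_(2 ^ n))) : 'M[C]_dimP := drsubmx (ptm E).

Definition Ec (E : 'End('M[C]_(2 ^ n))) : 'End('M[C]_(2 ^ n)) :=
  of_ptm (block_mx
    (ptm00 E) 0
    (ptm10 E) (ptm11 E - ptm10 E *m invmx (ptm00 E) *m ptm01 E)).

Definition Eq (E : 'End('M[C]_(2 ^ n))) : 'End('M[C]_(2 ^ n)) :=
  of_ptm (block_mx
    1%:M (invmx (ptm00 E) *m ptm01 E)
    0    1%:M).

Definition classically_tractable (E : 'End('M[C]_(2 ^ n))) : Prop :=
  (projZ \o E \o projPerp)%VF = 0.

(* E_00^-1 E_01 is a dimZ x dimP block; it is padded with zeros to become a map
   on all operators before composing with the projectors. *)
Definition Nq (E : 'End('M[C]_(2 ^ n))) : 'End('M[C]_(2 ^ n)) :=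
  (projZ \o of_ptm (block_mx 0 (invmx (ptm00 E) *m ptm01 E) 0 0) \o projPerp)%VF.

End Pauli.

(* Main.v *)
Require Import Defs.
From HB Require Import structures.
From mathcomp Require Import all_boot all_order all_algebra.
From mathcomp Require Import reals.
From mathcomp Require mxtens.
From mathcomp Require Import ring.

(* The normalized Paulis are orthonormal and there are 4^n of them, so maps
   correspond to their Pauli transfer matrices and composition to the matrix
   product.  E = Ec \o Eq is then the block LU factorization, and tractability and
   the shape of Eq are block computations.  For trace preservation: every Pauli
   outside {I, Z}^n is traceless, so the trace is the row vector (t, 0), and a map
   preserves it iff t *m E00 = t and t *m E01 = 0.  Both equations pass to Ec at
   once, and to Eq because t *m E00^-1 = t. *)

Set Implicit Arguments.
Unset Strict Implicit.
Unset Printing Implicit Defensive.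

Import Order.TTheory GRing.Theory Num.Theory.
Local Open Scope ring_scope.

(** * Linear functions as homomorphisms; traces of casts and Kronecker products *)

Lemma linfunE (K : fieldType) (aT rT : vectType K) (f : aT -> rT) :
  linear f -> linfun f =1 f.
Proof.
move=> lf; pose g : {linear aT -> rT} :=
  HB.pack f (GRing.isLinear.Build _ _ _ _ f lf).
exact: (lfunE g).
Qed.

Lemma mxtrace_castmx (T : pzRingType) (m k : nat) (e : m = k) (A : 'M[T]_m) :
  \tr (castmx (e, e) A) = \tr A.
Proof. by case: k / e; rewrite castmx_id. Qed.

Lemma mxtrace_tens (T : pzRingType) (m p : nat) (A : 'M[T]_m) (B : 'M[T]_p) :
  \tr (mxtens.tensmx A B) = \tr A * \tr B.
Proof.
by rewrite /mxtrace mxtens.mulr_sum; apply: eq_bigr => k _; rewrite !mxE.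
Qed.

(** * Traces and inner products of Pauli strings *)

Section PauliBasis.
Variable C : numClosedFieldType.

Let adj (m : nat) (A : 'M[C]_m) := map_mx Num.conj A^T.

(** Adjoints and products of Kronecker products are taken factor by factor, and the trace is
    multiplicative. The size [k] is a variable so that the cast along [e] can be eliminated. *)
Lemma hs_castmx_tens (m p k : nat) (e : (m * p)%N = k)
    (A A' : 'M[C]_m) (B B' : 'M[C]_p) :
  \tr (adj (castmx (e, e) (mxtens.tensmx A B)) *m
         castmx (e, e) (mxtens.tensmx A' B')) =
  \tr (adj A *m A') * \tr (adj B *m B').
Proof.
case: k / e; rewrite !castmx_id /adj mxtens.trmx_tens.
rewrite (mxtens.map_mxT (Num.conj : {rmorphism C -> C})) mxtens.tensmx_mul.
exact: mxtrace_tens.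
Qed.

Lemma tr_pauli_mx (p : pauli) :
  \tr (pauli_mx C p) = 2 * (p == PauliI)%:R.
Proof.
by case: p; rewrite /mxtrace /= !big_ord_recl big_ord0 !mxE /=; ring.
Qed.

Lemma hs_pauli_mx (p q : pauli) :
  \tr (adj (pauli_mx C p) *m pauli_mx C q) = 2 * (p == q)%:R.
Proof.
have i2 : 'i * 'i = -1 :> C by rewrite -expr2 sqrCi.
by case: p; case: q; rewrite /mxtrace /= !big_ord_recl big_ord0 !mxE
  !big_ord_recl !big_ord0 !mxE /= ?rmorphN ?rmorph1 ?rmorph0 /= ?conjCi;
  ring: i2.
Qed.

(** The trace is the product of the traces of the tensor factors, and a string outside [Zset n] has
    a factor X or Y, which is traceless. *)
Lemma tr_pauli_op (n : nat) (s : n.-tuple pauli) :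
  s \notin Zset n -> \tr (pauli_op C s) = 0.
Proof.
elim: n s => [|n IHn] s; first by rewrite tuple0 inE.
case/tupleP: s => p s; rewrite inE /= mxtrace_castmx mxtrace_tens theadE.
rewrite tr_pauli_mx (_ : [tuple of _] = s); last exact/val_inj.
rewrite negb_and => /orP[|sZ]; first by case: p; rewrite ?mulr0 ?mul0r.
by rewrite IHn ?mulr0 ?inE.
Qed.

Lemma hs_pauli_op (n : nat) (s t : n.-tuple pauli) :
  hs (pauli_op C s) (pauli_op C t) = (2 ^ n)%:R * (s == t)%:R.
Proof.
elim: n s t => [|n IHn] s t.
  by rewrite (tuple0 s) (tuple0 t) eqxx mulr1 /hs trmx1 map_mx1 mulmx1 mxtrace1.
case/tupleP: s => p s; case/tupleP: t => q t.
rewrite /hs /= (hs_castmx_tens (esym (expnS 2 n))) !theadE hs_pauli_mx.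
have beheadE (r : pauli) (u : n.-tuple pauli) :
  [tuple of behead [tuple of r :: u]] = u by exact/val_inj.
rewrite !beheadE [X in _ * X]IHn expnS natrM -!val_eqE /= eqseq_cons.
by rewrite -mulnb natrM; ring.
Qed.

(** * The normalized Pauli strings as an orthonormal basis *)

Variable n : nat.
Local Notation dimZ := #|Zset n|.
Local Notation dimP := #|~: Zset n|.
Local Notation N := (dimZ + dimP)%N.
Local Notation op := 'M[C]_(2 ^ n).

Lemma hs_npauli (s t : n.-tuple pauli) :
  hs (npauli C s) (npauli C t) = (s == t)%:R.
Proof.
rewrite /hs /npauli [(_ *: _)^T]linearZ /= map_mxZ -scalemxAl -scalemxAr !linearZ /=.
rewrite -/(hs _ _) hs_pauli_op /=.
set d : C := (2 ^ n)%:R.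
have d_gt0 : 0 < d by rewrite ltr0n expn_gt0.
(* The normalizing factor is real, so the conjugation in [hs] fixes it and its square cancels the
   2^n of [hs_pauli_op]. *)
have cd : (sqrtC d)^-1^* = (sqrtC d)^-1.
  by rewrite fmorphV /= conj_Creal // ger0_real ?sqrtC_ge0 ?ltW.
rewrite cd !mulrA -invfM -expr2 sqrtCK mulVf ?mul1r // gt_eqF //.
Qed.

Lemma hs_linear (A : op) a (B D : op) :
  hs A (a *: B + D) = a * hs A B + hs A D.
Proof. by rewrite /hs mulmxDr -scalemxAr mxtraceD mxtraceZ. Qed.

Lemma hs_sumr (I : finType) (A : op) (c : I -> C) (F : I -> op) :
  hs A (\sum_i c i *: F i) = \sum_i c i * hs A (F i).
Proof.
rewrite /hs mulmx_sumr linear_sum; apply: eq_bigr => i _.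
by rewrite -scalemxAr linearZ.
Qed.

(** Within each block this is injectivity of [enum_val]; across blocks, a common string would lie
    both in [Zset n] and in its complement. *)
Lemma basis_string_inj : injective (@basis_string n).
Proof.
move=> k l; rewrite /basis_string -[k]splitK -[l]splitK !unsplitK.
case: (split k) (split l) => [i|i] [j|j] /= eq_ij.
- by rewrite (enum_val_inj eq_ij).
- by have := enum_valP j; rewrite -eq_ij inE enum_valP.
- by have := enum_valP i; rewrite eq_ij inE enum_valP.
- by rewrite (enum_val_inj eq_ij).
Qed.

Lemma hs_basis (k l : 'I_N) : hs (basis C k) (basis C l) = (k == l)%:R.
Proof. by rewrite hs_npauli (inj_eq basis_string_inj). Qed.

(** An orthonormal family is free, and this one has 4^n = 2^n * 2^n members, the dimension of the
    operator space. Hence it is a basis, and pairing with its members reads off the coordinates. *)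
Lemma basis_expand (A : op) : A = \sum_k hs (basis C k) A *: basis C k.
Proof.
have card_pauli : #|{: pauli}| = 4%N.
  pose f (p : pauli) : bool * bool := pauli_code p.
  have fb : bijective f by exists pauli_decode; [case | case=> [[] []]].
  by rewrite (bij_eq_card fb) card_prod !card_bool.
pose X := [tuple basis C k | k < N].
have XE (k : 'I_N) : X`_k = basis C k by rewrite -tnth_nth tnth_mktuple.
have freeX : free X.
  apply/freeP => c c0 k.
  (* Pairing the vanishing combination with [basis C k] isolates the coefficient [c k]. *)
  have := congr1 (hs (basis C k)) c0.
  rewrite (eq_bigr (fun i => c i *: basis C i)) => [|i _]; last by rewrite XE.
  rewrite hs_sumr (bigD1 k) //= hs_basis eqxx mulr1 big1 => [|i ik].
    by rewrite addr0 => ->; rewrite /hs mulmx0 linear0.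
  by rewrite hs_basis eq_sym (negbTE ik) mulr0.
have basisX : basis_of fullv X.
  rewrite basisEfree freeX subvf dimvf dim_matrix size_tuple cardsC.
  by rewrite card_tuple card_pauli (expnMn 2 2 n) /=; apply: leqnn.
rewrite {1}(coord_basis basisX (memvf A)); apply: eq_bigr => k _.
rewrite XE; congr (_ *: _).
rewrite [in RHS](coord_basis basisX (memvf A)).
rewrite (eq_bigr (fun i => coord X i A *: basis C i)) => [|i _]; last by rewrite XE.
rewrite hs_sumr (bigD1 k) //= hs_basis eqxx mulr1 big1 ?addr0 // => i ik.
by rewrite hs_basis eq_sym (negbTE ik) mulr0.
Qed.

(** * The correspondence between maps and Pauli transfer matrices *)

Lemma eq_on_basis (E F : 'End(op)) :
  (forall k : 'I_N, E (basis C k) = F (basis C k)) -> E = F.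
Proof.
move=> EF; apply/lfunP => A; rewrite (basis_expand A) !linear_sum.
by apply: eq_bigr => k _; rewrite linearZ [RHS]linearZ /= EF.
Qed.

Lemma of_ptm_basis (M : 'M[C]_N) (k : 'I_N) :
  of_ptm M (basis C k) = \sum_i M i k *: basis C i.
Proof.
rewrite linfunE => [|a A B].
  apply: eq_bigr => i _; rewrite (bigD1 k) //= hs_basis eqxx mulr1 big1 ?addr0 //.
  by move=> j jk; rewrite hs_basis (negbTE jk) mulr0 scale0r.
rewrite scaler_sumr -big_split; apply: eq_bigr => i _.
rewrite scaler_sumr -big_split; apply: eq_bigr => j _ /=.
by move: (basis C i) => b; rewrite hs_linear mulrDr mulrCA scalerDl scalerA.
Qed.

Lemma ptmK (E : 'End(op)) : of_ptm (ptm E) = E.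
Proof.
apply: eq_on_basis => k; rewrite of_ptm_basis [RHS]basis_expand.
by apply: eq_bigr => i _; rewrite mxE.
Qed.

Lemma of_ptmM (M M' : 'M[C]_N) : of_ptm (M *m M') = (of_ptm M \o of_ptm M')%VF.
Proof.
apply: eq_on_basis => k; rewrite comp_lfunE !of_ptm_basis linear_sum.
rewrite [RHS](eq_bigr (fun j => \sum_i (M i j * M' j k) *: basis C i)) => [|j _].
  rewrite [RHS]exchange_big; apply: eq_bigr => i _.
  by rewrite mxE scaler_suml.
rewrite linearZ /= of_ptm_basis scaler_sumr; apply: eq_bigr => i _.
by rewrite scalerA mulrC.
Qed.

Lemma of_ptmD (M M' : 'M[C]_N) : of_ptm (M + M') = of_ptm M + of_ptm M'.
Proof.
apply: eq_on_basis => k; rewrite add_lfunE !of_ptm_basis -big_split.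
by apply: eq_bigr => i _; rewrite mxE scalerDl.
Qed.

Lemma of_ptm0 : of_ptm 0 = 0 :> 'End(op).
Proof. by apply: (addrI (of_ptm 0)); rewrite -of_ptmD !addr0. Qed.

Lemma of_ptm1 : of_ptm 1%:M = \1%VF :> 'End(op).
Proof.
apply: eq_on_basis => k; rewrite of_ptm_basis id_lfunE (bigD1 k) //= mxE eqxx.
rewrite scale1r big1 ?addr0 // => i ik.
by rewrite mxE (negbTE ik) scale0r.
Qed.

(** * The two projectors in block form *)

Lemma basis_lshift (i : 'I_dimZ) : basis C (lshift dimP i) = npauli C (enum_val i).
Proof. by rewrite /basis /basis_string (unsplitK (inl i)). Qed.

Lemma basis_rshift (j : 'I_dimP) : basis C (rshift dimZ j) = npauli C (enum_val j).
Proof. by rewrite /basis /basis_string (unsplitK (inr j)). Qed.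

Lemma projZE (A : op) :
  projZ C n A = \sum_(s in Zset n) hs (npauli C s) A *: npauli C s.
Proof.
rewrite linfunE // => a B D.
rewrite scaler_sumr -big_split; apply: eq_bigr => s _ /=.
by rewrite hs_linear scalerDl; congr (_ + _); apply/esym/scalerA.
Qed.

Lemma projZ_ptm : projZ C n = of_ptm (block_mx 1%:M 0 0 0).
Proof.
(* The sum over [Zset n] is reindexed by the first [dimZ] basis indices; on the matrix side the
   remaining rows are zero. *)
apply: eq_on_basis => k; rewrite projZE of_ptm_basis big_enum_val big_split_ord /=.
rewrite [X in _ = _ + X]big1 => [|j _]; last first.
  by rewrite -[k]splitK; case: (split k) => l /=;
    rewrite ?block_mxEdl ?block_mxEdr mxE scale0r.
rewrite addr0; apply: eq_bigr => i _; rewrite -basis_lshift; congr (_ *: _).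
rewrite hs_basis -[k]splitK; case: (split k) => l /=.
  by rewrite block_mxEul mxE eq_lshift.
by rewrite block_mxEur mxE eq_lrshift.
Qed.

Lemma projPerp_ptm : projPerp C n = of_ptm (block_mx 0 0 0 1%:M).
Proof.
apply/eqP; rewrite subr_eq projZ_ptm -of_ptmD add_block_mx !addr0 add0r.
by rewrite -scalar_mx_block of_ptm1.
Qed.

Lemma projZ_in_Zspace (A : op) : projZ C n A \in Zspace C n.
Proof.
rewrite projZE; apply: memv_suml => s sZ; apply/memvZ/memv_span/imageP.
by exists s.
Qed.

(** * Trace preservation in terms of blocks *)

Lemma trace_preserving_of_ptm (M : 'M[C]_N) :
  trace_preserving (of_ptm M) <->
  (\row_k \tr (basis C k)) *m M = \row_k \tr (basis C k).
Proof.
(* Applying a map multiplies the row of basis traces by its matrix; by linearity it suffices to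
   compare traces on the basis. *)
have trM (k : 'I_N) :
    \tr (of_ptm M (basis C k)) = ((\row_k \tr (basis C k)) *m M) 0 k.
  rewrite of_ptm_basis linear_sum mxE; apply: eq_bigr => i _.
  by rewrite /= mxtraceZ mxE mulrC.
split=> [tpM | tM A]; first by apply/rowP => k; rewrite -trM tpM mxE.
rewrite (basis_expand A) !linear_sum; apply: eq_bigr => k _.
by rewrite /= [X in \tr X]linearZ /= mxtraceZ [RHS]mxtraceZ trM tM mxE.
Qed.

(** The row t of the overview: the trace functional in coordinates on the Z-block. *)
Definition Ztrace : 'rV[C]_dimZ := \row_i \tr (npauli C (enum_val i)).

Lemma basis_traceE : \row_k \tr (basis C k) = row_mx Ztrace (0 : 'rV_dimP).
Proof.
apply/rowP => k; rewrite mxE -[k]splitK; case: (split k) => l /=.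
  by rewrite row_mxEl mxE basis_lshift.
rewrite row_mxEr mxE basis_rshift /npauli linearZ /= tr_pauli_op ?mulr0 //.
by have := enum_valP l; rewrite inE.
Qed.

Lemma trace_preserving_block (M00 : 'M[C]_dimZ) (M01 : 'M[C]_(dimZ, dimP))
    (M10 : 'M[C]_(dimP, dimZ)) (M11 : 'M[C]_dimP) :
  trace_preserving (of_ptm (block_mx M00 M01 M10 M11)) <->
  Ztrace *m M00 = Ztrace /\ Ztrace *m M01 = 0.
Proof.
rewrite trace_preserving_of_ptm basis_traceE mul_row_block !mul0mx !addr0.
by split=> [/eq_row_mx | [-> ->]].
Qed.

End PauliBasis.

Theorem proposition2 (R : realType) (n : nat) (E : 'End('M[R[i]]_(2 ^ n))) :
  trace_preserving E ->
  ptm00 E \in unitmx ->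
  [/\ E = (Ec E \o Eq E)%VF,
      trace_preserving (Ec E),
      trace_preserving (Eq E),
      classically_tractable (Ec E)
    & Eq E = (\1 + Nq E)%VF /\ (Nq E @: Zperp R[i] n <= Zspace R[i] n)%VS].
Proof.
move=> tpE E00u.
have ptmE : ptm E = block_mx (ptm00 E) (ptm01 E) (ptm10 E) (ptm11 E).
  by rewrite submxK.
(* The padded matrix lives in the upper right block alone, so the two projectors leave it
   unchanged. *)
have NqE : Nq E = of_ptm (block_mx 0 (invmx (ptm00 E) *m ptm01 E) 0 0).
  rewrite /Nq projZ_ptm projPerp_ptm -!of_ptmM !mulmx_block.
  by rewrite !(mulmx0, mul0mx, mul1mx, mulmx1, addr0, add0r).
move: tpE; rewrite -{1}[E]ptmK ptmE => /trace_preserving_block[tE00 tE01].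
have tE00V : Ztrace _ n *m invmx (ptm00 E) = Ztrace _ n by rewrite -{1}tE00 mulmxK.
split.
(* In the lower right block of the product, E10 E00^-1 E01 cancels the term subtracted in the Schur
   complement, leaving E11. *)
- rewrite -of_ptmM mulmx_block -{1}[E]ptmK ptmE.
  rewrite !mul0mx !mulmx0 !mulmx1 !addr0 !mulmxA mulmxV // mul1mx.
  by rewrite addrC subrK.
- by apply/trace_preserving_block; rewrite mulmx0.
- by apply/trace_preserving_block; rewrite mulmx1 mulmxA tE00V tE01.
(* The projectors cut out the upper right block, which is zero in [Ec E]. *)
- rewrite /classically_tractable projZ_ptm projPerp_ptm -!of_ptmM !mulmx_block.
  rewrite !(mulmx0, mul0mx, mul1mx, mulmx1, addr0, add0r).
  by rewrite block_mx0 of_ptm0.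
split.
  rewrite NqE -of_ptm1 -of_ptmD [X in of_ptm (X + _)]scalar_mx_block.
  by rewrite add_block_mx !addr0 add0r.
(* The outermost factor of [Nq E] is [projZ], so every value lies in [Zspace]. *)
by apply/subvP => _ /memv_imgP[A _ ->]; rewrite !comp_lfunE projZ_in_Zspace.
Qed.
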